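(* For any $0<\theta_{AB|CD}<1$, define $\theta_{BC|AD}=1-\theta_{AB|CD}$ and $\theta=(\theta_{AB|CD},\theta_{BC|AD})$, a probability distribution supported on the two bipartitions $AB|CD$ and $BC|AD$ of $\{A,B,C,D\}$. Let $\mathsf U_2=\sum_{i=1}^2 e_i\otimes e_i\otimes e_i\otimes e_i\in(\mathbb C^2)^{\otimes4}$. Then $$E_\theta(\mathsf U_2)\le1<E^\theta(\mathsf U_2),$$ where for the logarithmic upper quantum functional the order of operators is fixed as follows: $$E^\theta(\psi)=\sup\Big\{\theta_{AB|CD}H\big(\tfrac{\lambda_{AB|CD}}n\big)+\theta_{BC|AD}H\big(\tfrac{\lambda_{BC|AD}}n\big)\ :\ n\ge1,\ \lambda_{AB|CD},\lambda_{BC|AD}\vdash n,\ P^{AB|CD}_{\lambda_{AB|CD}}P^{BC|AD}_{\lambda_{BC|AD}}\psi^{\otimes n}\ne0\Big\}.$$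
   Context: Legs of a $4$-tensor $\psi\in V=V_A\otimes V_B\otimes V_C\otimes V_D$ are labelled $A,B,C,D$; $V_S=\bigotimes_{i\in S}V_i$, each $V_i=\mathbb C^{d_i}$ with standard inner product. $H$ is Shannon entropy with base-2 logarithm (von Neumann entropy for positive semidefinite trace-one operators). **Projectors.** For a bipartition $S|\overline S$ of $\{A,B,C,D\}$, $n\ge1$ and a partition $\lambda\vdash n$, $P_\lambda^{S|\overline S}=P_\lambda^{V_S}P_{(n)}^{V}$, where $P_\lambda^{V_S}$ is the projector on $V^{\otimes n}\cong V_S^{\otimes n}\otimes V_{\overline S}^{\otimes n}$ onto the $\lambda$-isotypic component for the symmetric group $S_n$ permuting the tensor factors of $V_S^{\otimes n}$ (acting trivially on $V_{\overline S}^{\otimes n}$), and $P_{(n)}^{V}$ is the projector onto the symmetric subspace of $V^{\otimes n}$. (The operators for $AB|CD$ and $BC|AD$ need not commute.) **Logarithmic lower quantum functional.** For $\psi\ne0$ let $\psi_S:V_{\overline S}^*\to V_S$ be the flattening, $\rho_S=\psi_S\psi_S^*/\|\psi\|_2^2$, $H_{S|\overline S}(\psi)=H(\rho_S)$, $H_\theta=\sum_b\theta_bH_b$, and $E_\theta(\psi)=\sup H_\theta((A_1\otimes A_2\otimes A_3\otimes A_4)\psi)$ over invertible $A_j$ on the four local spaces. *)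

(* Defs.v *)
From HB Require Import structures.
From mathcomp Require Import all_boot all_order all_algebra all_fingroup.
From mathcomp Require Import spectral.
From mathcomp Require Import complex.
From mathcomp Require Import all_classical all_reals all_analysis.
Set Implicit Arguments.
Unset Strict Implicit.
Unset Printing Implicit Defensive.
Import Order.TTheory GRing.Theory Num.Theory.
Local Open Scope classical_set_scope.
Local Open Scope ring_scope.
Local Open Scope sesquilinear_scope.
Local Open Scope complex_scope.

(* Base-2 entropy of a finite list of weights; since ln 0 = 0, zero weights
   contribute nothing. *)
Definition shannon (R : realType) (s : seq R) : R :=
  - \sum_(p <- s) p * (ln p / ln 2).

(* For a Hermitian rho, the entries of spectral_diag rho are its (real)
   eigenvalues counted with multiplicity. *)
Definition von_neumann (R : realType) (m : nat) (rho : 'M[R[i]]_m) : R :=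
  shannon [seq complex.Re (spectral_diag rho 0 k) | k <- enum 'I_m].

Definition leg : finType := 'I_4.
Definition legA : leg := @Ordinal 4 0 isT.
Definition legB : leg := @Ordinal 4 1 isT.
Definition legC : leg := @Ordinal 4 2 isT.
Definition legD : leg := @Ordinal 4 3 isT.

(* A bipartition S | ~: S of the legs is represented by its first side S. *)
Definition AB : {set leg} := [set legA; legB]%SET.
Definition BC : {set leg} := [set legB; legC]%SET.

(* Indices of the standard basis of V = C^(d A) (x) ... (x) C^(d D), and of
   V_S; side_part S x is the S-part of the index x. *)
Definition multi_idx (d : leg -> nat) : finType := {dffun forall i : leg, 'I_(d i)}.
Definition side_idx (d : leg -> nat) (S : {set leg}) : finType :=
  {dffun forall i : {i : leg | i \in S}, 'I_(d (val i))}.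
Definition side_part (d : leg -> nat) (S : {set leg}) (x : multi_idx d) :
    side_idx d S :=
  finfun (fun i : {i : leg | i \in S} => x (val i)).

Definition tensor (R : realType) (d : leg -> nat) : Type :=
  {ffun multi_idx d -> R[i]^o}.

Definition local_act (R : realType) (d : leg -> nat)
    (A : forall i : leg, 'M[R[i]]_(d i)) (psi : tensor R d) : tensor R d :=
  [ffun x : multi_idx d =>
    \sum_(y : multi_idx d) (\prod_(i : leg) A i (x i) (y i)) * psi y].

(* Exactly one x has prescribed S- and ~: S-parts, so each entry is a single
   coordinate of psi. *)
Definition flattening (R : realType) (d : leg -> nat) (S : {set leg})
    (psi : tensor R d) :
    'M[R[i]]_(#|side_idx d S|, #|side_idx d (~: S)%SET|) :=
  \matrix_(a, b) \sum_(x : multi_idx d |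
    (side_part S x == enum_val a) && (side_part (~: S)%SET x == enum_val b)) psi x.

Definition sqnorm (R : realType) (d : leg -> nat) (psi : tensor R d) : R[i] :=
  \sum_(x : multi_idx d) `|psi x : R[i]| ^+ 2.

Definition density (R : realType) (d : leg -> nat) (S : {set leg})
    (psi : tensor R d) : 'M[R[i]]_(#|side_idx d S|) :=
  (sqnorm psi)^-1 *: (flattening S psi *m (flattening S psi)^t*).

Definition H_flat (R : realType) (d : leg -> nat) (S : {set leg})
    (psi : tensor R d) : R :=
  von_neumann (density S psi).

Definition H_theta (R : realType) (d : leg -> nat) (theta : {set leg} -> R)
    (psi : tensor R d) : R :=
  \sum_(S : {set leg}) theta S * H_flat S psi.

Definition E_lower (R : realType) (d : leg -> nat) (theta : {set leg} -> R)
    (psi : tensor R d) : \bar R :=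
  ereal_sup [set e : \bar R | exists2 A : forall i : leg, 'M[R[i]]_(d i),
    (forall i, A i \in unitmx) & e = (H_theta theta (local_act A psi))%:E].

Definition is_partition (n : nat) (lam : seq nat) : bool :=
  [&& sorted geq lam, 0%N \notin lam & sumn lam == n].

(* The group algebra C[S_n], as the right regular module: (u . s)(g) = u(g s^-1).
   In mathcomp (s * t) k = t (s k), so right modules over 'S_n are the left
   modules over S_n with the usual composition of permutations. *)
Definition group_algebra (R : realType) (n : nat) : vectType R[i] :=
  {ffun 'S_n -> R[i]^o}.

Definition translate (R : realType) (n : nat) (u : group_algebra R n)
    (s : 'S_n) : group_algebra R n :=
  [ffun g : 'S_n => (u : {ffun 'S_n -> R[i]^o}) (g * s^-1)%g].

(* The Young tableau of shape lam filled row by row: the entry k lies in row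
   reshape_index lam k and column reshape_offset lam k. *)
Definition row_stab (n : nat) (lam : seq nat) : {set 'S_n} :=
  [set p : 'S_n | [forall k, reshape_index lam (p k) == reshape_index lam k]]%SET.
Definition col_stab (n : nat) (lam : seq nat) : {set 'S_n} :=
  [set q : 'S_n | [forall k, reshape_offset lam (q k) == reshape_offset lam k]]%SET.

(* Since q * p is p after q, this is a_lam * b_lam in the usual group algebra. *)
Definition young_symmetrizer (R : realType) (n : nat) (lam : seq nat) :
    group_algebra R n :=
  [ffun g : 'S_n => \sum_(p in row_stab n lam)
     \sum_(q in col_stab n lam | (q * p)%g == g) (-1) ^+ odd_perm q].

Definition specht (R : realType) (n : nat) (lam : seq nat) :
    {vspace group_algebra R n} :=
  (<<[seq translate (young_symmetrizer R n lam) s | s <- enum 'S_n]>>)%VS.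

Definition tensor_power_space (R : realType) (d : leg -> nat) (n : nat) :
    vectType R[i] :=
  {ffun {ffun 'I_n -> multi_idx d} -> R[i]^o}.

Definition coords (R : realType) (d : leg -> nat) (n : nat)
    (v : tensor_power_space R d n) :
    {ffun {ffun 'I_n -> multi_idx d} -> R[i]^o} := v.

Definition tensor_power (R : realType) (d : leg -> nat) (n : nat)
    (psi : tensor R d) : tensor_power_space R d n :=
  [ffun x : {ffun 'I_n -> multi_idx d} => \prod_(k < n) psi (x k)].

Definition permute_index (d : leg -> nat) (n : nat) (S : {set leg}) (s : 'S_n)
    (x : {ffun 'I_n -> multi_idx d}) : {ffun 'I_n -> multi_idx d} :=
  [ffun k : 'I_n =>
    finfun (fun i : leg => if i \in S then x (s k) i else x k i) : multi_idx d].

(* s permutes the n tensor factors of V_S^(x n), sending a product of basis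
   vectors e_(x 0) (x) ... (x) e_(x (n-1)) to the one with e_(x k) in place s k,
   and fixes V_(~: S)^(x n). *)
Definition permute (R : realType) (d : leg -> nat) (n : nat) (S : {set leg})
    (s : 'S_n) (v : tensor_power_space R d n) : tensor_power_space R d n :=
  [ffun x : {ffun 'I_n -> multi_idx d} => coords v (permute_index S s x)].

Definition specht_copy (R : realType) (d : leg -> nat) (n : nat)
    (S : {set leg}) (lam : seq nat) (U : {vspace tensor_power_space R d n}) :
    Prop :=
  exists f : 'Hom(group_algebra R n, tensor_power_space R d n),
    [/\ (f @: specht R n lam)%VS = U,
        {in specht R n lam &, injective f}
      & forall u s, u \in specht R n lam ->
          f (translate u s) = permute S s (f u)].

Definition isotypic (R : realType) (d : leg -> nat) (n : nat)
    (S : {set leg}) (lam : seq nat) : set (tensor_power_space R d n) :=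
  [set v | exists2 Us : seq {vspace tensor_power_space R d n},
     (forall U, U \in Us -> specht_copy S lam U) &
     v \in (\sum_(U <- Us) U)%VS].

Definition symmetric_subspace (R : realType) (d : leg -> nat) (n : nat) :
    set (tensor_power_space R d n) :=
  [set v | forall s : 'S_n, permute [set: leg]%SET s v = v].

Definition inner (R : realType) (d : leg -> nat) (n : nat)
    (u v : tensor_power_space R d n) : R[i] :=
  \sum_(x : {ffun 'I_n -> multi_idx d}) Num.conj (coords u x : R[i]) * coords v x.

(* For W a subspace this is the orthogonal projection onto W: it exists and is
   unique, so the default value 0 is not used. *)
Definition orth_proj (R : realType) (d : leg -> nat) (n : nat)
    (W : set (tensor_power_space R d n)) (v : tensor_power_space R d n) :
    tensor_power_space R d n :=
  xget 0 [set w | W w /\ forall u, W u -> inner u (v - w) = 0].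

Definition proj (R : realType) (d : leg -> nat) (n : nat) (S : {set leg})
    (lam : seq nat) (v : tensor_power_space R d n) : tensor_power_space R d n :=
  orth_proj (isotypic S lam) (orth_proj (@symmetric_subspace R d n) v).

Definition shape_entropy (R : realType) (n : nat) (lam : seq nat) : R :=
  shannon [seq (l%:R / n%:R : R) | l <- lam].

Definition E_upper (R : realType) (d : leg -> nat) (theta : {set leg} -> R)
    (psi : tensor R d) : \bar R :=
  ereal_sup [set e : \bar R | exists (n : nat) (lamAB lamBC : seq nat),
    [/\ (1 <= n)%N,
        is_partition n lamAB,
        is_partition n lamBC,
        proj AB lamAB (proj BC lamBC (tensor_power n psi)) != 0
      & e = (theta AB * shape_entropy R n lamAB
             + theta BC * shape_entropy R n lamBC)%:E]].

Definition theta_of (R : realType) (t : R) (S : {set leg}) : R :=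
  if S == AB then t else if S == BC then 1 - t else 0.

Definition U2 (R : realType) : tensor R (fun=> 2%N) :=
  [ffun x : multi_idx (fun=> 2%N) =>
    \sum_(i < 2) \prod_(j : leg) (x j == i)%:R].

(* Main.v *)
Require Import Defs.
From HB Require Import structures.
From mathcomp Require Import all_boot all_order all_algebra all_fingroup.
From mathcomp Require Import spectral complex ring lra.
From mathcomp Require Import all_classical all_reals all_analysis.
Set Implicit Arguments.
Unset Strict Implicit.
Unset Printing Implicit Defensive.
Import Order.TTheory GRing.Theory Num.Theory.
Local Open Scope ring_scope.
Local Open Scope complex_scope.
Local Open Scope sesquilinear_scope.

(** Lower functional.  Every tensor in the orbit of the unit tensor is a sum of
two product tensors, so each of its flattenings has rank at most 2
([rank_flattening_U2]).  A density matrix of rank at most 2 has at most two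
nonzero eigenvalues, hence entropy at most 1 ([shannon_le1]), and a convex
combination of such entropies is at most 1.

Upper functional.  One admissible triple suffices: n = 4, the shape (2,2) for
BC|AD, with entropy 1, and the shape (1,1,1,1) for AB|CD, with entropy 2.  Its
value is 2 t + (1 - t) = 1 + t.  What has to be shown is that the two
projections do not annihilate the fourth power of the unit tensor.

Both isotypic components have an explicit description.  The (1,1,1,1)-component
consists of the vectors on which a permutation acts by its sign, and the
orthogonal projection onto it is the antisymmetrizer ([orth_proj_sign]).  The
irreducible representation of shape (2,2) is pulled back along the quotient of
the symmetric group on four points by the Klein four-group, which is the
symmetric group on three points; it is the two-dimensional representation of
the latter.  So the (2,2)-component consists of the vectors fixed by the Klein
four-group and killed by 1 + c + c^2 for a 3-cycle c ([isotypic22P]), and the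
projection onto it is V (2 - c - c^2) / 12, with V the sum of the Klein
four-group ([orth_proj22]).  One inclusion holds because the Young symmetrizer
itself has these two properties.  For the other, the vectors with these
properties are spanned by images of the Young symmetrizer under equivariant
maps, and such a map is zero or injective on the Specht module: a Schur lemma
that is checked on the basis Y, Y b of the Specht module, where Y is the Young
symmetrizer and b a transposition ([alg_act22_inj]).

It remains to see one nonzero coordinate of the doubly projected vector.  Index
the four tensor factors by pairs of bits and take the coordinate where the legs
A and D carry the first bit and B and C the second.  The vector obtained from
the first projection is supported on indices where A agrees with D and B with
C; permuting the legs A and B of the chosen index keeps it in this support only
for the identity permutation, because the pair of bits determines the factor.
So the antisymmetrizer contributes a single term ([proj_neq0]), and the
coordinate of the first projection there is -1/6 ([part22_witness]). *)

(** * Spectra of Gram matrices *)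

Section Gram.
Variables (C : numClosedFieldType) (m p : nat) (F : 'M[C]_(m, p)) (c : C).
Hypothesis c_ge0 : 0 <= c.
Let rho := c *: (F *m F^t*).
Let P := spectralmx rho.
Let D := spectral_diag rho.

Lemma gram_normal : rho \is normalmx.
Proof.
have adj : rho^t* = rho.
  rewrite /rho linearZ /= map_mxZ trmx_mul map_mxM /= trmxCK.
  by rewrite (CrealP _) // ger0_real.
by apply/normalmxP; rewrite adj.
Qed.

Lemma gram_spectral : diag_mx D = P *m rho *m P^t*.
Proof.
have uP : P \is unitarymx := spectral_unitarymx rho.
rewrite {1}(orthomx_spectralP gram_normal) -/P -/D invmx_unitary //.
by rewrite !mulmxA (unitarymxP uP) mul1mx mulmxtVK.
Qed.

Lemma gram_spectral_ge0 k : 0 <= D 0 k.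
Proof.
have -> : D 0 k = c * \sum_j (P *m F) k j * Num.conj ((P *m F) k j).
  have := congr1 (fun M : 'M[C]_m => M k k) gram_spectral.
  rewrite /rho -scalemxAr -scalemxAl.
  have -> : P *m (F *m F^t*) *m P^t* = (P *m F) *m (P *m F)^t*.
    by rewrite trmx_mul map_mxM !mulmxA.
  by rewrite !mxE eqxx mulr1n => ->; congr (_ * _); apply: eq_bigr => j _; rewrite !mxE.
by apply: mulr_ge0 => //; apply: sumr_ge0 => j _; apply: mul_conjC_ge0.
Qed.

Lemma gram_spectral_sum : \sum_k D 0 k = \tr rho.
Proof.
rewrite -mxtrace_diag gram_spectral mxtrace_mulC mulmxA.
by rewrite (mulmx1C (unitarymxP (spectral_unitarymx rho))) mul1mx.
Qed.

(** Selecting the nonzero eigenvalues exhibits the identity matrix of their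
number as a product through the diagonalized Gram matrix. *)
Lemma gram_spectral_support : (#|[set k : 'I_m | (D 0 k != 0)%R]%SET| <= \rank F)%N.
Proof.
set Z := [set k | _]%SET.
pose f := @enum_val _ (mem Z).
pose X : 'M[C]_(#|Z|, m) := \matrix_(i, k) ((k == f i)%:R * (D 0 k)^-1).
pose Y : 'M[C]_(m, #|Z|) := \matrix_(k, j) (k == f j)%:R.
have XDY : X *m diag_mx D *m Y = 1%:M.
  apply/matrixP => i j; rewrite mul_mx_diag !mxE (bigD1 (f i)) //= big1 => [|k ne].
    rewrite !mxE eqxx mul1r mulVf ?mul1r ?addr0 ?(inj_eq enum_val_inj) //.
    by have := enum_valP i; rewrite inE.
  by rewrite !mxE (negPf ne) !mul0r.
rewrite -[X in (X <= _)%N](mxrank1 C) -XDY.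
apply: leq_trans (mxrankM_maxl _ _) _; apply: leq_trans (mxrankM_maxr _ _) _.
rewrite gram_spectral; apply: leq_trans (mxrankM_maxl _ _) _.
apply: leq_trans (mxrankM_maxr _ _) _; rewrite /rho scalemxAl.
apply: leq_trans (mxrankM_maxl _ _) _.
exact: mxrank_scale.
Qed.
End Gram.

(** * Entropy of at most two weights *)

Section Entropy.
Variable R : realType.
Local Notation C := R[i].

Let ln2_gt0 : 0 < ln (2 : R). Proof. by rewrite ln_gt0 // ltr1n. Qed.

(** The tangent to the logarithm at 1, evaluated at 1 / (2 x); equality holds at
the weight 1/2, so that summing over at most two weights gives the sharp
bound. *)
Lemma entropy_term_le (x : R) : 0 < x -> - (x * ln x) <= x * ln 2 + (2^-1 - x).
Proof.
move=> x0; have x20 : 0 < 2 * x by rewrite mulr_gt0.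
have h : ln ((2 * x)^-1) <= (2 * x)^-1 - 1.
  have := @le_ln1Dx R ((2 * x)^-1 - 1); rewrite (addrC 1) subrK; apply.
  by rewrite ltrBDl subrr invr_gt0.
rewrite lnV ?posrE // lnM ?posrE // in h.
have := ler_wpM2l (ltW x0) h.
rewrite mulrBr mulr1 invfM mulrCA mulfV ?gt_eqF // mulr1 mulrN mulrDr => h'.
lra.
Qed.

Lemma shannon_le1 (m : nat) (p : 'I_m -> R) : (forall k, 0 <= p k) ->
  \sum_k p k = 1 -> (#|[set k | (p k != 0)%R]%SET| <= 2)%N ->
  shannon [seq p k | k <- enum 'I_m] <= 1.
Proof.
move=> p0 p1 supp; rewrite /shannon big_map big_enum /=.
under eq_bigr => k _ do rewrite mulrA.
rewrite -mulr_suml -mulNr ler_pdivrMr // mul1r -sumrN.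
have -> : \sum_k - (p k * ln (p k)) = \sum_(k in [set k | (p k != 0)%R]%SET) - (p k * ln (p k)).
  rewrite [RHS]big_mkcond; apply: eq_bigr => k _; rewrite inE.
  by case: eqP => [->|]; rewrite ?mul0r ?oppr0.
apply: (@le_trans _ _ (\sum_(k in [set k | (p k != 0)%R]%SET) (p k * ln 2 + (2^-1 - p k)))).
  by apply: ler_sum => k; rewrite inE => pk; apply: entropy_term_le; rewrite lt_def pk p0.
have ps : \sum_(k in [set k | (p k != 0)%R]%SET) p k = 1.
  rewrite -p1 big_mkcond; apply: eq_bigr => k _; rewrite inE.
  by case: eqP.
rewrite big_split /= -mulr_suml ps mul1r big_split /= sumrN ps sumr_const.
by rewrite gerDl subr_le0 -[_^-1 *+ _]mulr_natl ler_pdivrMr // mul1r ler_nat.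
Qed.

(** The trace 0 covers the zero vector, whose density matrix is 0. *)
Lemma von_neumann_gram_le1 (m q : nat) (F : 'M[C]_(m, q)) (c : C) : 0 <= c ->
  (\rank F <= 2)%N -> \tr (c *: (F *m F^t*)) \in [:: 0; 1] ->
  von_neumann (c *: (F *m F^t*)) <= 1.
Proof.
move=> c0 rk; rewrite -(gram_spectral_sum F c0) /von_neumann.
have supp := leq_trans (gram_spectral_support F c0) rk.
have ge0 := gram_spectral_ge0 F c0.
move: (spectral_diag _) supp ge0 => D supp ge0.
have DE k : D 0 k = (complex.Re (D 0 k))%:C by rewrite RRe_real // ger0_real.
have Re_ge0 k : 0 <= complex.Re (D 0 k) by rewrite -lecR -DE.
rewrite (eq_bigr _ (fun k _ => DE k)) -(raddf_sum (@real_complex R)) !inE.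
move=> /orP[|]; last first.
  rewrite (inj_eq (@complexI R)) => /eqP sum1; apply: shannon_le1 => //.
  apply: leq_trans supp; apply/subset_leq_card/fintype.subsetP => k; rewrite !inE.
  by apply: contraNN => /eqP ->.
rewrite (inj_eq (@complexI R)) psumr_eq0 // => /allP D0.
rewrite /shannon big_map big1 ?oppr0 ?ler01 // => k _.
by have /eqP -> := D0 k (mem_index_enum k); rewrite mul0r.
Qed.

End Entropy.

(** * Flattenings *)

Section Flattening.
Variables (R : realType) (d : leg -> nat) (S : {set leg}).
Local Notation C := R[i].

Lemma notin_compl (i : leg) : ~ i \in S -> i \in (~: S)%SET.
Proof. by move/negP; rewrite inE. Qed.

Definition glue (a : side_idx d S) (b : side_idx d (~: S)%SET) : multi_idx d :=
  finfun (fun i : leg => match @idP (i \in S) with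
    | ReflectT h => a (exist _ i h)
    | ReflectF h => b (exist _ i (notin_compl h))
    end).

Lemma glueP a b x : (side_part S x == a) && (side_part (~: S)%SET x == b) = (x == glue a b).
Proof.
apply/idP/eqP => [/andP[/eqP <- /eqP <-]|->].
  by apply/ffunP => i; rewrite ffunE; case: {-}_ / idP => h; rewrite ffunE.
apply/andP; split; apply/eqP/ffunP => -[i h]; rewrite !ffunE /=; case: {-}_ / idP => h'.
- by rewrite (bool_irrelevance h' h).
- by case: h'.
- by exfalso; move: h; rewrite inE h'.
by rewrite (bool_irrelevance (notin_compl h') h).
Qed.

Lemma flatteningE (psi : tensor R d) a b :
  flattening S psi a b = psi (glue (enum_val a) (enum_val b)).
Proof. by rewrite mxE (big_pred1 (glue (enum_val a) (enum_val b))) // => x; apply: glueP. Qed.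

Lemma sum_glue (V : nmodType) (f : multi_idx d -> V) :
  \sum_x f x = \sum_(a < #|side_idx d S|) \sum_(b < #|side_idx d (~: S)%SET|)
                f (glue (enum_val a) (enum_val b)).
Proof.
rewrite (partition_big (fun x => enum_rank (side_part S x)) xpredT) //=.
apply: eq_bigr => a _.
rewrite (partition_big (fun x => enum_rank (side_part (~: S)%SET x)) xpredT) //=.
apply: eq_bigr => b _; rewrite (big_pred1 (glue (enum_val a) (enum_val b))) // => x.
by rewrite /= -glueP; congr (_ && _); rewrite -(inj_eq enum_val_inj) enum_rankK.
Qed.

Lemma density_trace (psi : tensor R d) : \tr (density S psi) \in [:: 0; 1].
Proof.
have trE : \tr (flattening S psi *m (flattening S psi)^t*) = sqnorm psi.
  rewrite /sqnorm sum_glue; apply: eq_bigr => a _; rewrite mxE.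
  apply: eq_bigr => b _; rewrite [X in _ * X](_ : _ = Num.conj (flattening S psi a b)).
    by rewrite flatteningE normCK.
  by rewrite 2!mxE.
rewrite /density mxtraceZ trE !inE.
have [->|ne] := eqVneq (sqnorm psi) 0; first by rewrite mulr0 eqxx.
by rewrite mulVf // eqxx orbT.
Qed.

Lemma H_flat_le1 (psi : tensor R d) : (\rank (flattening S psi) <= 2)%N -> H_flat S psi <= 1.
Proof.
move=> rk; apply: von_neumann_gram_le1 (density_trace psi) => //.
by rewrite invr_ge0; apply: sumr_ge0 => x _; rewrite exprn_ge0.
Qed.
End Flattening.

Lemma BC_neq_AB : BC != AB.
Proof. by apply/eqP => /setP/(_ legA); rewrite !inE. Qed.

Section Lower.
Variable R : realType.
Local Notation C := R[i].
Local Notation d := (fun _ : leg => 2%N).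

(** The unit tensor restricts the sum over indices to the constant ones. *)
Lemma local_act_U2 (A : forall i : leg, 'M[C]_(d i)) x :
  local_act A (U2 R) x = \sum_(i < 2) \prod_(j : leg) A j (x j) i.
Proof.
rewrite ffunE; under eq_bigr => y _ do rewrite ffunE mulr_sumr.
rewrite exchange_big; apply: eq_bigr => i _ /=.
rewrite (bigD1 (finfun (fun=> i) : multi_idx d)) //= [X in _ + X]big1 => [|y ne].
  rewrite addr0 [X in _ * X]big1 ?mulr1 => [|j _]; last by rewrite ffunE eqxx.
  by apply: eq_bigr => j _; rewrite ffunE.
have [j yj] : exists j, y j != i.
  apply/existsP; apply: contraR ne; rewrite negb_exists => /forallP h.
  by apply/eqP/ffunP => j; rewrite ffunE; apply/eqP; have := h j; rewrite negbK.
by rewrite [X in _ * X](bigD1 j) //= (negPf yj) mul0r mulr0.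
Qed.

(** A leg outside the side contributes the default factor 1. *)
Definition side_prod (A : forall i : leg, 'M[C]_(d i)) (S : {set leg})
    (a : side_idx d S) (i : 'I_2) : C :=
  \prod_(j : leg) oapp (fun k : {j : leg | j \in S} => A (val k) (a k) i) 1 (insub j).

Lemma rank_flattening_U2 A S : (\rank (flattening S (local_act A (U2 R))) <= 2)%N.
Proof.
pose L := \matrix_(a < #|side_idx d S|, i < 2) side_prod A (enum_val a) i.
pose M := \matrix_(i < 2, b < #|side_idx d (~: S)%SET|) side_prod A (enum_val b) i.
have -> : flattening S (local_act A (U2 R)) = L *m M.
  apply/matrixP => a b; rewrite flatteningE local_act_U2 mxE.
  apply: eq_bigr => i _; rewrite !mxE /side_prod -big_split /=.
  set x := glue _ _; have /andP[/eqP <- /eqP <-] :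
    (side_part S x == enum_val a) && (side_part (~: S)%SET x == enum_val b).
    by rewrite glueP.
  apply: eq_bigr => j _.
  have [jS|jS] := boolP (j \in S).
    rewrite (insubT (fun j => j \in S) jS) insubN ?inE ?jS //=.
    by rewrite mulr1 [side_part _ _ _]ffunE.
  have jS' : j \in (~: S)%SET by rewrite inE.
  rewrite insubN // (insubT (fun j => j \in (~: S)%SET) jS') /=.
  by rewrite mul1r [side_part _ _ _]ffunE.
exact: leq_trans (mxrankM_maxl _ _) (rank_leq_col _).
Qed.

Lemma E_lower_le1 (t : R) : 0 < t -> t < 1 -> (E_lower (theta_of t) (U2 R) <= 1)%E.
Proof.
move=> t0 t1; apply: ge_ereal_sup => _ [A _ ->]; rewrite lee_fin /H_theta.
rewrite (bigD1 AB) // (bigD1 BC) ?BC_neq_AB //=.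
rewrite [X in _ + (_ + X)]big1 => [|S /andP[/negPf nAB /negPf nBC]]; last first.
  by rewrite /theta_of nAB nBC mul0r.
rewrite /theta_of eqxx (negPf BC_neq_AB) eqxx addr0.
have HAB := H_flat_le1 (rank_flattening_U2 A AB).
have HBC := H_flat_le1 (rank_flattening_U2 A BC).
have := ler_wpM2l (ltW t0) HAB.
have t1' : 0 <= 1 - t by rewrite subr_ge0 ltW.
have := ler_wpM2l t1' HBC.
lra.
Qed.
End Lower.

(** * The irreducible representation of shape (2,2) by generators *)

(** The symmetric group on four points is generated by the transpositions
a = (0 1) and b = (0 2) together with the double transpositions
k1 = (0 1)(2 3) and k2 = (0 2)(1 3).  The record lists the relations between the
operators A, B, K1, K2 by which they act; [relK2A] and [relK1B] say that
conjugation exchanges one of k1, k2 with the third double transposition.  Read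
from left to right, the equations between words bring every word into the form
of an element of the symmetric group on 0, 1, 2 applied after an element of the
Klein four-group, which is what makes the coordinatewise proofs below work. *)
Record klein_sym3 (K : numFieldType) (X : finType)
    (A B K1 K2 : {ffun X -> K^o} -> {ffun X -> K^o}) : Prop := KleinSym3 {
  relAD : forall u v, A (u + v) = A u + A v;
  relBD : forall u v, B (u + v) = B u + B v;
  relK1D : forall u v, K1 (u + v) = K1 u + K1 v;
  relK2D : forall u v, K2 (u + v) = K2 u + K2 v;
  relAZ : forall c u, A (c *: u) = c *: A u;
  relAN : forall u, A (- u) = - A u;
  relBN : forall u, B (- u) = - B u;
  relK1N : forall u, K1 (- u) = - K1 u;
  relK2N : forall u, K2 (- u) = - K2 u;
  relAA : forall w, A (A w) = w;
  relBB : forall w, B (B w) = w;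
  relBAB : forall w, B (A (B w)) = A (B (A w));
  relK11 : forall w, K1 (K1 w) = w;
  relK22 : forall w, K2 (K2 w) = w;
  relK21 : forall w, K2 (K1 w) = K1 (K2 w);
  relK1A : forall w, K1 (A w) = A (K1 w);
  relK2A : forall w, K2 (A w) = A (K1 (K2 w));
  relK1B : forall w, K1 (B w) = B (K1 (K2 w));
  relK2B : forall w, K2 (B w) = B (K2 w)
}.

Section Relations.
Variables (K : numFieldType) (X : finType).
Local Notation M := {ffun X -> K^o}.
Variables A B K1 K2 : M -> M.
Hypothesis rel : klein_sym3 A B K1 K2.
Let AD := relAD rel.
Let BD := relBD rel.
Let K1D := relK1D rel.
Let K2D := relK2D rel.
Let AZ' := relAZ rel.
Let AN := relAN rel.
Let BN := relBN rel.
Let K1N := relK1N rel.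
Let K2N := relK2N rel.
Let AA := relAA rel.
Let BB := relBB rel.
Let BAB := relBAB rel.
Let K11 := relK11 rel.
Let K22 := relK22 rel.
Let K21 := relK21 rel.
Let K1A := relK1A rel.
Let K2A := relK2A rel.
Let K1B := relK1B rel.
Let K2B := relK2B rel.

(** A B and B A are the two 3-cycles on 0, 1, 2. *)
Definition type22 (w : M) : Prop :=
  [/\ K1 w = w, K2 w = w & w + A (B w) + B (A w) = 0].

Definition klein_sum (w : M) : M := w + K1 w + K2 w + K1 (K2 w).

(** The action of the Young symmetrizer of shape (2,2), with the Klein four-group
factored out; see [alg_act_young22]. *)
Definition young_vec (w : M) : M := klein_sum (w - B w + A (w - B w)).

Let lin := (AD, BD, K1D, K2D,
  AN, BN, K1N, K2N,
  AA, BB, BAB, K11, K22, K21, K1A, K2A, K1B, K2B).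

Let ffD (u v : M) x : (u + v) x = u x + v x. Proof. by rewrite ffunE. Qed.
Let ffN (u : M) x : (- u) x = - u x. Proof. by rewrite ffunE. Qed.
Let ff0 x : (0 : M) x = 0. Proof. by rewrite ffunE. Qed.
Let ffZ a (u : M) x : (a *: u) x = a * u x. Proof. by rewrite ffunE. Qed.
Let ff := (ffD, ffN, ff0, ffZ).

Let A0 : A 0 = 0. Proof. by apply: (addrI (A 0)); rewrite -AD !addr0. Qed.
Let B0 : B 0 = 0. Proof. by apply: (addrI (B 0)); rewrite -BD !addr0. Qed.

Lemma type22_young_vec w : type22 (young_vec w).
Proof.
rewrite /type22 /young_vec /klein_sum.
by split; apply/ffunP => x; rewrite !lin !ff; ring.
Qed.

Lemma type22_klein_sum w : type22 (klein_sum (w + w - A (B w) - B (A w))).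
Proof.
rewrite /type22 /klein_sum.
by split; apply/ffunP => x; rewrite !lin !ff; ring.
Qed.

Lemma young_vec_fixed w : A (young_vec w) = young_vec w.
Proof.
by rewrite /young_vec /klein_sum; apply/ffunP => x; rewrite !lin !ff; ring.
Qed.

Lemma type22A w : type22 w -> type22 (A w).
Proof.
case=> h1 h2 h3; split; first by rewrite K1A h1.
  by rewrite K2A h2 h1.
by have := congr1 A h3; rewrite !lin A0 => <-; apply/ffunP => x; rewrite !ff; ring.
Qed.

Lemma type22B w : type22 w -> type22 (B w).
Proof.
case=> h1 h2 h3; split; first by rewrite K1B h2 h1.
  by rewrite K2B h2.
by have := congr1 B h3; rewrite !lin B0 => <-; apply/ffunP => x; rewrite !ff; ring.
Qed.

(** On a vector w of this type, [young_vec] is 4 (1 + A)(1 - B) and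
(1 - B)(1 + A)(1 - B) w = 3 (1 - B) w, so Q contains every (1 - B) w.  As A is
conjugate to B, it contains every (1 - A) w too, and 3 w is a combination of
vectors of these two kinds, because 3 = (1 - A B) + (1 - B A) on w. *)
Lemma type22_ind (Q : M -> Prop) :
  (forall w z, Q w -> Q z -> Q (w + z)) -> (forall c w, Q w -> Q (c *: w)) ->
  (forall w, Q w -> Q (A w)) -> (forall w, Q w -> Q (B w)) ->
  (forall w, type22 w -> Q (young_vec w)) ->
  forall w, type22 w -> Q w.
Proof.
move=> QD QZ QA QB Qy.
have QBw w : type22 w -> Q (w - B w).
  move=> hw; have [h1 h2 h3] := hw.
  have -> : w - B w = 12^-1 *: (young_vec w - B (young_vec w)).
    apply/ffunP => x; rewrite /young_vec /klein_sum !(lin, h1, h2) !ff.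
    have /ffunP/(_ x) := h3; rewrite !ff => e.
    have := congr1 B h3; rewrite !lin B0 => /ffunP/(_ x); rewrite !ff => e'.
    have -> : A (B w) x = - w x - B (A w) x by rewrite -[RHS]addr0 -e; ring.
    have -> : A (B (A w)) x = - B w x - A w x by rewrite -[RHS]addr0 -e'; ring.
    by field.
  apply: (QZ); apply: (QD _ _ (Qy _ hw)); rewrite -scaleN1r.
  exact/QZ/QB/Qy.
(* A = (A B A) B (A B A) *)
have QAw w : type22 w -> Q (w - A w).
  move=> hw; have {1}-> : w - A w = A (B (A (A (B (A w)) - B (A (B (A w)))))).
    by rewrite !lin.
  by apply/QA/QB/QA/QBw/type22A/type22B/type22A.
move=> w hw; have [h1 h2 h3] := hw.
have -> : w = 3^-1 *: ((w - A w) + A (w - B w) + ((w - B w) + B (w - A w))).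
  apply/ffunP => x; rewrite !lin !ff.
  have /ffunP/(_ x) := h3; rewrite !ff => e.
  have -> : A (B w) x = - w x - B (A w) x by rewrite -[RHS]addr0 -e; ring.
  by field.
by apply: (QZ); apply: (QD); apply: (QD); auto.
Qed.

(** An equivariant image y of the Young symmetrizer satisfies the hypotheses.
Applying A to the relation, with A B y = - y - B y, and adding the two gives
(2 a - b) y = 0.  If y is nonzero then b = 2 a, so that a = 0 or y = - 2 B y; the
latter gives y = 4 y, because B is an involution. *)
Lemma type22_free y a b :
  type22 y -> A y = y -> a *: y + b *: B y = 0 ->
  y = 0 \/ a = 0 /\ b = 0.
Proof.
move=> [h1 h2 h3] Ay e.
have {h3} ABy : A (B y) = - y - B y.
  apply/ffunP => x; have /ffunP/(_ x) := h3; rewrite Ay !ff => e3.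
  by rewrite -[RHS]addr0 -e3; ring.
have [y0|y0] := eqVneq y 0; [by left | right].
have e1 : (a *+ 2 - b) *: y = 0.
  have := congr1 A e; rewrite A0 AD AZ' AZ' Ay ABy => e'.
  have -> : (a *+ 2 - b) *: y
      = (a *: y + b *: B y) + (a *: y + b *: (- y - B y)).
    by apply/ffunP => x; rewrite !ff; ring.
  by rewrite e e' addr0.
have eb : b = a *+ 2.
  by apply/eqP; move/eqP: e1; rewrite scaler_eq0 (negPf y0) orbF subr_eq0 eq_sym.
have [a0|a0] := eqVneq a 0; first by rewrite eb a0 mul0rn.
have yB : y + (B y + B y) = 0.
  apply: (scalerI a0); rewrite scaler0 -e eb.
  by apply/ffunP => x; rewrite !ff; ring.
have := congr1 B yB; rewrite !lin B0 => yB'.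
case/negP: y0; apply/eqP/ffunP => x; rewrite ff0.
have /ffunP/(_ x) := yB; have /ffunP/(_ x) := yB'; rewrite !ff => h' h.
apply: (@mulfI _ (3 : K)); first by rewrite pnatr_eq0.
have -> : 3 * y x = 2 * (B y x + (y x + y x)) - (y x + (B y x + B y x)) by ring.
by rewrite h h' !mulr0 subrr.
Qed.
End Relations.

(** * Generators of the symmetric group on four points *)

Local Notation pt k := (@Ordinal 4 k isT).
(** Locked, since otherwise unification unfolds k1 and k2 when it looks for a
product of permutations. *)
HB.lock Definition s01 : 'S_4 := tperm (pt 0) (pt 1).
HB.lock Definition s02 : 'S_4 := tperm (pt 0) (pt 2).
HB.lock Definition k1 : 'S_4 := (tperm (pt 0) (pt 1) * tperm (pt 2) (pt 3))%g.
HB.lock Definition k2 : 'S_4 := (tperm (pt 0) (pt 2) * tperm (pt 1) (pt 3))%g.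

(** Compares two explicit permutations at each of the four points. *)
Local Ltac S4eq := rewrite ?(s01.unlock, s02.unlock, k1.unlock, k2.unlock);
  apply/permP => -[[|[|[|[|//]]]] ?]; apply: val_inj;
  do 12 ?[progress rewrite ?permM ?perm1 ?permE /=]; by [].

Lemma s01K : (s01 * s01 = 1)%g. Proof. S4eq. Qed.
Lemma s02K : (s02 * s02 = 1)%g. Proof. S4eq. Qed.
Lemma k1K : (k1 * k1 = 1)%g. Proof. S4eq. Qed.
Lemma k2K : (k2 * k2 = 1)%g. Proof. S4eq. Qed.
Lemma s020102 : (s02 * s01 * s02 = s01 * s02 * s01)%g. Proof. S4eq. Qed.
Lemma k1k2 : (k1 * k2 = k2 * k1)%g. Proof. S4eq. Qed.
Lemma s01k1 : (s01 * k1 = k1 * s01)%g. Proof. S4eq. Qed.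
Lemma s02k2 : (s02 * k2 = k2 * s02)%g. Proof. S4eq. Qed.
Lemma s01k2 : (s01 * k2 = k2 * k1 * s01)%g. Proof. S4eq. Qed.
Lemma s02k1 : (s02 * k1 = k2 * k1 * s02)%g. Proof. S4eq. Qed.
Lemma s03E : (tperm (pt 0) (pt 3) = k1 * k2 * s01 * s02 * s01)%g.
Proof. S4eq. Qed.
Lemma s23E : (tperm (pt 2) (pt 3) = s01 * k1)%g. Proof. S4eq. Qed.
Lemma s13E : (tperm (pt 1) (pt 3) = s02 * k2)%g. Proof. S4eq. Qed.

Lemma pair_stab (F : 'I_4 -> nat) (x y z t : 'I_4) :
  uniq [:: x; y; z; t] -> F x = F y -> F z = F t -> F x <> F z ->
  [set p : 'S_4 | [forall k, F (p k) == F k]]%SET =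
  [set 1%g; tperm x y; tperm z t; (tperm x y * tperm z t)%g]%SET.
Proof.
move=> u4 Fxy Fzt Fxz.
have cover k : k \in [:: x; y; z; t].
  have /subset_cardP : #|[:: x; y; z; t]| = #|'I_4| by rewrite (card_uniqP u4) card_ord.
  by move=> /(_ (subset_predT _)) ->.
have Fxy_mem k : F k = F x -> k = x \/ k = y.
  by have := cover k; rewrite !inE => /or4P[] /eqP ->; rewrite -?Fzt; auto=> /esym.
have Fzt_mem k : F k = F z -> k = z \/ k = t.
  by have := cover k; rewrite !inE => /or4P[] /eqP ->; rewrite -?Fxy; auto.
have Fs a b k : F a = F b -> F (tperm a b k) = F k by case: tpermP => [->|->|].
apply/setP => p; rewrite !inE; apply/forallP/idP; last first.
  by case/orP => [/orP[/orP[]|]|] /eqP -> k; rewrite ?perm1 ?permM ?Fs.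
move=> /(_ _)/eqP pF.
have pinj a b : p a = p b -> a = b by apply: perm_inj.
move: u4; rewrite /= !inE !negb_or !andbT => /and3P[].
move=> /and3P[nxy nxz nxt] /andP[nyz nyt] nzt.
have two a b : (forall k, F k = F a -> k = a \/ k = b) -> F a = F b -> a != b ->
    p a = a /\ p b = b \/ p a = b /\ p b = a.
  move=> mem Fab /eqP nab; case: (mem _ (pF a)) => pa; [left | right];
  by (case: (mem (p b)); rewrite ?pF // => pb; split=> //; case: nab; apply: pinj;
    rewrite pa pb).
have pE (q : 'S_4) : (forall k, k \in [:: x; y; z; t] -> p k = q k) -> p = q.
  by move=> h; apply/permP => k; apply: h.
have yx : y != x by rewrite eq_sym.
have tz : t != z by rewrite eq_sym.
have [zx tx] : z != x /\ t != x by rewrite ![_ == x]eq_sym.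
have [zy ty] : z != y /\ t != y by rewrite ![_ == y]eq_sym.
case: (two _ _ Fxy_mem Fxy nxy) => -[px py]; case: (two _ _ Fzt_mem Fzt nzt) => -[pz pt'].
- rewrite (pE 1%g) ?eqxx // => k; rewrite !inE => /or4P[] /eqP ->; by rewrite perm1.
- rewrite (pE (tperm z t)) ?eqxx ?orbT // => k.
  by rewrite !inE => /or4P[] /eqP ->; rewrite ?tpermL ?tpermR // tpermD.
- rewrite (pE (tperm x y)) ?eqxx ?orbT // => k.
  by rewrite !inE => /or4P[] /eqP ->; rewrite ?tpermL ?tpermR // tpermD // eq_sym.
rewrite (pE (tperm x y * tperm z t)%g) ?eqxx ?orbT // => k.
rewrite !inE => /or4P[] /eqP ->; rewrite permM.
- by rewrite tpermL tpermD.
- by rewrite tpermR tpermD.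
- by rewrite (tpermD (z := z)) ?tpermL // eq_sym.
by rewrite (tpermD (z := t)) ?tpermR // eq_sym.
Qed.

Lemma row_stab22 : row_stab 4 [:: 2; 2] =
  [set 1%g; s01; tperm (pt 2) (pt 3); k1]%SET.
Proof.
rewrite ?(s01.unlock, s02.unlock, k1.unlock, k2.unlock).
exact: pair_stab.
Qed.

Lemma col_stab22 : col_stab 4 [:: 2; 2] =
  [set 1%g; s02; tperm (pt 1) (pt 3); k2]%SET.
Proof.
rewrite ?(s01.unlock, s02.unlock, k1.unlock, k2.unlock).
exact: pair_stab.
Qed.

Lemma pair_stab_uniq (x y z t : 'I_4) : uniq [:: x; y; z; t] ->
  uniq [:: 1%g; tperm x y; tperm z t; (tperm x y * tperm z t)%g].
Proof.
rewrite /= !inE !negb_or !andbT => /and3P[].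
move=> /and3P[nxy nxz nxt] /andP[nyz nyt] nzt.
have [zx tx] : z != x /\ t != x by rewrite ![_ == x]eq_sym.
have [zy ty] : z != y /\ t != y by rewrite ![_ == y]eq_sym.
have ne (p q : 'S_4) k : p k != q k -> p != q by apply: contraNneq => ->.
apply/and3P; split; first (apply/and3P; split).
- by apply: (ne _ _ x); rewrite perm1 tpermL.
- by apply: (ne _ _ z); rewrite perm1 tpermL.
- by apply: (ne _ _ x); rewrite perm1 permM tpermL tpermD.
- apply/andP; split; first by apply: (ne _ _ x); rewrite tpermL tpermD // eq_sym.
  by apply: (ne _ _ z); rewrite permM (tpermD nxz nyz) tpermL.
by apply: (ne _ _ x); rewrite permM tpermL !tpermD // eq_sym.
Qed.

Lemma sum_set4 (V : nmodType) (T : finType) (x y z t : T) (F : T -> V) :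
  uniq [:: x; y; z; t] ->
  \sum_(p in [set x; y; z; t]%SET) F p = F x + F y + F z + F t.
Proof.
move=> u4; rewrite (eq_bigl (mem [:: x; y; z; t])) => [|p]; last first.
  by rewrite !inE -!orbA.
by rewrite -big_uniq //= !big_cons big_nil addr0 !addrA.
Qed.

(** The transpositions (0 j) generate, and (0 3) is the product of the third double
transposition and a b a = (1 2). *)
Lemma S4_ind (Q : 'S_4 -> Prop) : Q 1%g ->
  (forall s, Q s -> [/\ Q (s * s01)%g, Q (s * s02)%g, Q (s * k1)%g & Q (s * k2)%g]) ->
  forall s, Q s.
Proof.
move=> Q1 QM s.
have : s \in [set: 'S_4]%SET by rewrite inE.
rewrite -(gen_tperm (pt 0)) => /gen_prodgP[m [c hc ->]].
elim: m c hc => [|m IH] c hc; first by rewrite big_ord0.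
rewrite big_ord_recr /=.
set r := (\prod_(i < m) _)%g.
have Qr : Q r by apply: IH => i.
have /imsetP[y _ ->] := hc ord_max.
case: y => [[|[|[|[|//]]]] hy].
- by rewrite (_ : Ordinal hy = pt 0) ?tperm1 ?mulg1 //; apply: val_inj.
- by rewrite (_ : Ordinal hy = pt 1) -?s01.unlock; [case: (QM _ Qr) | apply: val_inj].
- by rewrite (_ : Ordinal hy = pt 2) -?s02.unlock; [case: (QM _ Qr) | apply: val_inj].
rewrite (_ : Ordinal hy = pt 3); last exact: val_inj.
rewrite s03E.
have [_ _ /QM[_ _ _ /QM[h _ _ _]] _] := QM _ Qr.
by have [_ /QM[h2 _ _ _] _ _] := QM _ h; rewrite !mulgA.
Qed.

(** * Permutation modules and the group algebra *)

Section PermutationModule.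
Variables (R : realType) (n : nat) (X : finType) (act : 'S_n -> X -> X).
Hypothesis act1 : forall x, act 1%g x = x.
Hypothesis actM : forall s t x, act (s * t)%g x = act s (act t x).
Local Notation C := R[i].
Local Notation M := {ffun X -> C^o}.

(** Functions on a finite set with an action of the symmetric group.  Both the group
algebra with right translation ([translate_shift]) and the tensor power with
[permute] are convertible to instances, and both are right modules. *)
Definition shift (s : 'S_n) (v : M) : M := [ffun x => v (act s x)].

Lemma shiftD s u v : shift s (u + v) = shift s u + shift s v.
Proof. by apply/ffunP => x; rewrite !ffunE. Qed.
Lemma shiftN s v : shift s (- v) = - shift s v.
Proof. by apply/ffunP => x; rewrite !ffunE. Qed.
Lemma shiftZ s (c : C) v : shift s (c *: v) = c *: shift s v.
Proof. by apply/ffunP => x; rewrite !ffunE. Qed.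
Lemma shift0 s : shift s 0 = 0.
Proof. by apply/ffunP => x; rewrite !ffunE. Qed.
Lemma shift_sum s (I : finType) (P : pred I) (F : I -> M) :
  shift s (\sum_(i | P i) F i) = \sum_(i | P i) shift s (F i).
Proof. exact: (big_morph _ (shiftD s) (shift0 s)). Qed.
Lemma shift1 v : shift 1%g v = v.
Proof. by apply/ffunP => x; rewrite !ffunE act1. Qed.
Lemma shiftM s t v : shift t (shift s v) = shift (s * t)%g v.
Proof. by apply/ffunP => x; rewrite !ffunE actM. Qed.

(** The equivariant map from the group algebra that sends the unit to w. *)
Definition alg_act (w : M) (u : group_algebra R n) : M :=
  \sum_(g : 'S_n) ((u : {ffun 'S_n -> C^o}) g : C) *: shift g w.

Lemma alg_act_is_linear w : linear (alg_act w).
Proof.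
move=> c u v; rewrite /alg_act scaler_sumr -big_split /=; apply: eq_bigr => g _.
by rewrite !ffunE scalerDl scalerA.
Qed.

HB.instance Definition _ w :=
  GRing.isLinear.Build C (group_algebra R n) M *:%R (alg_act w) (alg_act_is_linear w).

Lemma alg_act_translate w u s : alg_act w (translate u s) = shift s (alg_act w u).
Proof.
rewrite /alg_act shift_sum (reindex_inj (mulIg s)) /=; apply: eq_bigr => g _.
by rewrite ffunE mulgK shiftZ shiftM.
Qed.

Lemma alg_act_young w lam : alg_act w (young_symmetrizer R n lam) =
  \sum_(p in row_stab n lam) \sum_(q in col_stab n lam)
    ((-1) ^+ odd_perm q : C) *: shift p (shift q w).
Proof.
rewrite /alg_act.
under eq_bigr => g _ do rewrite ffunE scaler_suml.
rewrite exchange_big /=; apply: eq_bigr => p _.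
under eq_bigr => g _ do rewrite scaler_suml big_mkcondr /=.
rewrite exchange_big /=; apply: eq_bigr => q _.
rewrite (bigD1 (q * p)%g) //= eqxx big1 ?addr0 ?shiftM // => g.
by rewrite eq_sym => /negPf ->.
Qed.
End PermutationModule.

(** Unlike [ffunE], the next two equations do not unfold the vectors. *)
Lemma ffunE_add (X : finType) (V : nmodType) (u v : {ffun X -> V}) x :
  (u + v) x = u x + v x.
Proof. by rewrite ffunE. Qed.
Lemma ffunE_opp (X : finType) (V : zmodType) (u : {ffun X -> V}) x :
  (- u) x = - u x.
Proof. by rewrite ffunE. Qed.

(** * The Young symmetrizer of shape (2,2) *)

Section TwoRows.
Variables (R : realType) (X : finType) (act : 'S_4 -> X -> X).
Hypothesis act1 : forall x, act 1%g x = x.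
Hypothesis actM : forall s t x, act (s * t)%g x = act s (act t x).
Local Notation C := R[i].
Local Notation M := {ffun X -> C^o}.
Local Notation A := (@shift R 4 X act s01).
Local Notation B := (@shift R 4 X act s02).
Local Notation K1 := (@shift R 4 X act k1).
Local Notation K2 := (@shift R 4 X act k2).
Let sM := shiftM (R:=R) actM.
Let s1 := shift1 (R:=R) act1.

Lemma klein_sym3_shift : klein_sym3 A B K1 K2.
Proof.
split=> *; rewrite ?(shiftD, shiftN, shiftZ, sM) //.
- by rewrite s01K s1.
- by rewrite s02K s1.
- by rewrite !mulgA s020102.
- by rewrite k1K s1.
- by rewrite k2K s1.
- by rewrite k1k2.
- by rewrite s01k1.
- by rewrite mulgA s01k2.
- by rewrite mulgA s02k1.
- by rewrite s02k2.
Qed.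

(** The rows {0,1}, {2,3} give the factor (1 + a)(1 + k1), the columns {0,2}, {1,3}
give (1 - b)(1 + k2), and k2 normalizes the row stabilizer, so that its factor can
be moved to the front. *)
Lemma alg_act_young22 w :
  alg_act act w (young_symmetrizer R 4 [:: 2; 2]) = young_vec A B K1 K2 w.
Proof.
rewrite alg_act_young // row_stab22 col_stab22.
have uR : uniq [:: 1%g; s01; tperm (pt 2) (pt 3); k1].
  by rewrite s01.unlock k1.unlock; apply: pair_stab_uniq.
have uC : uniq [:: 1%g; s02; tperm (pt 1) (pt 3); k2].
  by rewrite s02.unlock k2.unlock; apply: pair_stab_uniq.
have o1 : odd_perm s02 by rewrite s02.unlock odd_tperm.
have o3 : odd_perm k2 = false by rewrite k2.unlock odd_permM !odd_tperm.
have inner z : \sum_(q in [set 1%g; s02; tperm (pt 1) (pt 3); k2]%SET)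
    ((-1) ^+ odd_perm q : C) *: shift act z (shift act q w)
  = shift act z (w - B w - K2 (B w) + K2 w).
  rewrite sum_set4 // odd_perm1 o1 o3 odd_tperm /= !expr0 expr1 !scaleN1r !scale1r.
  by rewrite s13E !(shiftD, shiftN, sM) mul1g !mulgA.
under eq_bigr => p _ do rewrite inner.
rewrite sum_set4 // s1 s23E -sM.
have rel := klein_sym3_shift.
rewrite /young_vec /klein_sum !(shiftD, shiftN).
rewrite !(relK11 rel, relK22 rel, relK21 rel, relK1A rel, relK2A rel, relK1B rel, relK2B rel).
apply/ffunP => x; rewrite !(ffunE_add, ffunE_opp); ring.
Qed.
Lemma type22D (u v : M) : type22 A B K1 K2 u -> type22 A B K1 K2 v ->
  type22 A B K1 K2 (u + v).
Proof.
case=> h1 h2 h3 [g1 g2 g3]; split; [by rewrite shiftD h1 g1 | by rewrite shiftD h2 g2 |].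
by rewrite !shiftD (addrACA u v) (addrACA (u + _)) h3 g3 addr0.
Qed.

Lemma type22Z (c : C) (u : M) : type22 A B K1 K2 u -> type22 A B K1 K2 (c *: u).
Proof.
case=> h1 h2 h3; split; rewrite ?shiftZ ?h1 ?h2 //.
by rewrite -!scalerDr h3 scaler0.
Qed.

Lemma type22_shift s (w : M) : type22 A B K1 K2 w ->
  type22 A B K1 K2 (shift act s w).
Proof.
have rel := klein_sym3_shift.
elim/S4_ind: s w => [w|s IH]; first by rewrite s1.
split=> w /IH hw; rewrite -sM.
- exact: type22A.
- exact: type22B.
- by case: (hw) => ->.
- by case: (hw) => _ ->.
Qed.
End TwoRows.

(** * Specht modules *)

Lemma span_ind (K : fieldType) (V : vectType K) (s : seq V) (P : V -> Prop) :
  P 0 -> (forall u v, P u -> P v -> P (u + v)) -> (forall c u, P u -> P (c *: u)) ->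
  {in s, forall u, P u} -> {in << s >>%VS, forall u, P u}.
Proof.
move=> P0 PD PZ Ps u hu; rewrite (coord_span (X := in_tuple s) hu).
elim/big_ind: _ => // i _; apply/PZ/Ps/mem_nth; exact: (ltn_ord i).
Qed.

Section Specht.
Variables (R : realType) (n : nat) (lam : seq nat).
Local Notation C := R[i].
Local Notation Y := (young_symmetrizer R n lam).
Definition rmul (s g : 'S_n) : 'S_n := (g * s^-1)%g.

Lemma rmul1 g : rmul 1 g = g. Proof. by rewrite /rmul invg1 mulg1. Qed.
Lemma rmulM s t g : rmul (s * t) g = rmul s (rmul t g).
Proof. by rewrite /rmul invMg mulgA. Qed.

Lemma translate_shift (u : group_algebra R n) s : translate u s = shift rmul s u.
Proof. by []. Qed.

Lemma specht_ind (P : group_algebra R n -> Prop) :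
  P 0 -> (forall u v, P u -> P v -> P (u + v)) -> (forall c u, P u -> P (c *: u)) ->
  (forall s, P (translate Y s)) -> {in specht R n lam, forall u, P u}.
Proof.
move=> P0 PD PZ PY; apply: span_ind => // u /mapP[s _ ->]; exact: PY.
Qed.

Lemma young_in_specht : Y \in specht R n lam.
Proof.
apply: memv_span; apply/mapP; exists 1%g; first by rewrite mem_enum.
by rewrite translate_shift shift1 //; exact: rmul1.
Qed.

Lemma translateM (u : group_algebra R n) s t :
  translate (translate u s) t = translate u (s * t)%g.
Proof. exact: (shiftM rmulM). Qed.

Lemma specht_translate s : {in specht R n lam, forall u, translate u s \in specht R n lam}.
Proof.
apply: specht_ind.
- by rewrite translate_shift shift0 mem0v.
- by move=> u v hu hv; rewrite translate_shift shiftD memvD.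
- by move=> c u hu; rewrite translate_shift shiftZ memvZ.
move=> t; rewrite translateM; apply: memv_span; apply/mapP.
by exists (t * s)%g; rewrite ?mem_enum.
Qed.

(** Hence every element of the group algebra, in particular the Young symmetrizer, is
an instance of [alg_act]. *)
Lemma alg_act_unit (u : group_algebra R n) :
  alg_act rmul [ffun g => (g == 1%g)%:R] u = u.
Proof.
apply/ffunP => x; rewrite /alg_act sum_ffunE (bigD1 x) //= !ffunE /rmul mulgV eqxx.
rewrite big1 ?addr0 => [|g ne]; first exact: mulr1.
by rewrite !ffunE -eq_mulgV1 eq_sym (negPf ne) /GRing.scale /= mulr0.
Qed.
End Specht.

Section Specht22.
Variables (R : realType).
Local Notation C := R[i].
Local Notation Y := (young_symmetrizer R 4 [:: 2; 2]).
Local Notation tr := (@shift R 4 'S_4 (@rmul 4)).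
Local Notation t22 := (type22 (tr s01) (tr s02) (tr k1) (tr k2)).

Let relT := klein_sym3_shift R (@rmul1 4) (@rmulM 4).

Lemma young22E :
  exists w, Y = young_vec (tr s01) (tr s02) (tr k1) (tr k2) w.
Proof.
exists [ffun g => (g == 1%g)%:R].
by rewrite -(alg_act_young22 (@rmul1 4) (@rmulM 4)) alg_act_unit.
Qed.

Lemma young22_type : t22 Y.
Proof. by have [w ->] := young22E; apply: type22_young_vec. Qed.

Lemma young22_s01 : tr s01 Y = Y.
Proof. by have [w ->] := young22E; apply: young_vec_fixed. Qed.

Lemma specht22_type : {in specht R 4 [:: 2; 2], forall u, t22 u}.
Proof.
apply: specht_ind => [||c u|s].
- by split; rewrite !shift0 ?addr0.
- exact: type22D.
- exact: type22Z.
exact: (type22_shift (@rmul1 4) (@rmulM 4) _ young22_type).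
Qed.

(** The span is stable under the four generators: A exchanges B Y with - Y - B Y. *)
Lemma specht22_span : {in specht R 4 [:: 2; 2], forall u,
  exists a b : C, u = a *: Y + b *: tr s02 Y}.
Proof.
have [h1 h2 h3] := young22_type.
have [g1 g2 _] := type22B relT young22_type.
apply: specht_ind => [|u v [a [b ->]] [c [d ->]]|c u [a [b ->]]|s].
- by exists 0, 0; rewrite !scale0r addr0.
- by exists (a + c), (b + d); rewrite addrACA -(scalerDl Y a c) -(scalerDl (tr s02 Y) b d).
- by exists (c * a), (c * b); rewrite scalerDr !scalerA.
elim/S4_ind: s => [|s [a [b e]]].
  by exists 1, 0; rewrite translate_shift shift1 ?scale1r ?scale0r ?addr0 //; exact: rmul1.
rewrite translate_shift in e; rewrite !translate_shift -!(shiftM (@rmulM 4)) e; split.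
- exists (a - b), (- b); rewrite shiftD !shiftZ young22_s01.
  have -> : tr s01 (tr s02 Y) = - Y - tr s02 Y.
    rewrite young22_s01 in h3; apply/eqP; rewrite -subr_eq0 opprD !opprK.
    by rewrite addrA (addrC _ Y) h3.
  by rewrite scalerBl scaleNr scalerBr scalerN addrA.
- by exists b, a; rewrite shiftD !shiftZ (relBB relT); exact: addrC.
- by exists a, b; rewrite shiftD !shiftZ h1 g1.
by exists a, b; rewrite shiftD !shiftZ h2 g2.
Qed.

Section Injectivity.
Variables (X : finType) (act : 'S_4 -> X -> X).
Hypothesis act1 : forall x, act 1%g x = x.
Hypothesis actM : forall s t x, act (s * t)%g x = act s (act t x).

Lemma alg_act22_inj w : alg_act act w Y != 0 ->
  {in specht R 4 [:: 2; 2], forall u, alg_act act w u = 0 -> u = 0}.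
Proof.
move=> ne u /specht22_span[a [b ->]].
rewrite linearD !linearZ /= -translate_shift alg_act_translate //.
set y := alg_act act w Y in ne *; move=> e.
have rel := klein_sym3_shift R act1 actM.
have yE : y = young_vec _ _ _ _ w := alg_act_young22 act1 actM w.
have yt22 : type22 (shift act s01) (shift act s02) (shift act k1) (shift act k2) y.
  by rewrite yE; apply: type22_young_vec.
have yA : shift act s01 y = y by rewrite yE; apply: young_vec_fixed.
have [/eqP|[-> ->]] := type22_free rel yt22 yA e; first by rewrite (negPf ne).
by rewrite !scale0r addr0.
Qed.
End Injectivity.
End Specht22.

(** * Isotypic components and orthogonal projections *)

Section TensorPower.
Variables (R : realType) (d : leg -> nat) (n : nat).
Local Notation C := R[i].
Local Notation T := (tensor_power_space R d n).
Implicit Types (S : {set leg}) (lam : seq nat) (s t : 'S_n) (u v w : T).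

Lemma permute_index1 S (x : {ffun 'I_n -> multi_idx d}) :
  permute_index S 1%g x = x.
Proof. by apply/ffunP => k; rewrite ffunE; apply/ffunP => i; rewrite ffunE perm1 if_same. Qed.

Lemma permute_indexM S s t (x : {ffun 'I_n -> multi_idx d}) :
  permute_index S (s * t)%g x = permute_index S s (permute_index S t x).
Proof.
apply/ffunP => k; rewrite !ffunE; apply/ffunP => i; rewrite !ffunE permM.
by case: (i \in S).
Qed.

Lemma permuteD S s v w : permute S s (v + w) = permute S s v + permute S s w.
Proof. exact: shiftD. Qed.
Lemma permuteN S s v : permute S s (- v) = - permute S s v.
Proof. exact: shiftN. Qed.
Lemma permuteB S s v w : permute S s (v - w) = permute S s v - permute S s w.
Proof. by rewrite permuteD permuteN. Qed.
Lemma permute0 S s : permute S s 0 = 0 :> T.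
Proof. exact: shift0. Qed.
Lemma permute1 S v : permute S 1%g v = v.
Proof. exact: (shift1 (@permute_index1 S)). Qed.

Lemma isotypic0 S lam : isotypic S lam (0 : T).
Proof. by exists [::]; rewrite ?big_nil ?mem0v. Qed.

Lemma isotypicD S lam v w : isotypic S lam v -> isotypic S lam w -> isotypic S lam (v + w).
Proof.
move=> [Us hU vU] [Ws hW wW]; exists (Us ++ Ws); last by rewrite big_cat memv_add.
by move=> U; rewrite mem_cat => /orP[/hU|/hW].
Qed.

Lemma isotypicZ S lam (c : C) v : isotypic S lam v -> isotypic S lam (c *: v).
Proof. by move=> [Us hU vU]; exists Us; rewrite ?memvZ. Qed.

Lemma isotypicB S lam v w : isotypic S lam v -> isotypic S lam w -> isotypic S lam (v - w).
Proof. by move=> hv hw; rewrite -scaleN1r; apply/isotypicD/isotypicZ. Qed.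

(** An isotypic vector is a sum of images f u of elements of the Specht module, with
f equivariant and each f u isotypic. *)
Lemma isotypic_ind S lam (P : T -> Prop) :
  P 0 -> (forall v w, P v -> P w -> P (v + w)) ->
  (forall f : 'Hom(group_algebra R n, T),
     (forall (u : group_algebra R n) s, u \in specht R n lam ->
        f (translate u s) = permute S s (f u)) ->
     (forall u : group_algebra R n, u \in specht R n lam -> isotypic S lam (f u)) ->
     forall u : group_algebra R n, u \in specht R n lam -> P (f u)) ->
  forall v, isotypic S lam v -> P v.
Proof.
move=> P0 PD Pf v [Us hU].
elim: Us v hU => [|U Us IH] v hU; first by rewrite big_nil memv0 => /eqP ->.
rewrite big_cons => /memv_addP[u uU [w wU ->]].
apply: PD; last by apply: IH wU => W hW; apply: hU; rewrite inE hW orbT.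
have [f [fU finj feq]] := hU U (mem_head _ _).
move: uU; rewrite -fU => /memv_imgP[x xS ->]; apply: Pf => // y yS.
exists [:: U]; last by rewrite big_seq1 -fU memv_img.
by move=> W; rewrite inE => /eqP ->; exists f.
Qed.

Lemma isotypic_permute S lam s v : isotypic S lam v -> isotypic S lam (permute S s v).
Proof.
move: v; apply: isotypic_ind => [|v w hv hw|f feq fiso u hu].
- by rewrite permute0; apply: isotypic0.
- by rewrite permuteD; apply: isotypicD.
by rewrite -feq //; apply/fiso/specht_translate.
Qed.

Lemma isotypic_alg_act S lam w :
  {in specht R n lam, forall u : group_algebra R n, alg_act (permute_index S) w u = 0 -> u = 0} ->
  {in specht R n lam, forall u : group_algebra R n, isotypic S lam (alg_act (permute_index S) w u)}.
Proof.
move=> inj u hu.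
pose f : 'Hom(group_algebra R n, T) := linfun (alg_act (permute_index S) w).
exists [:: (f @: specht R n lam)%VS]; last first.
  by rewrite big_seq1; apply/memv_imgP; exists u => //; rewrite lfunE.
move=> U; rewrite inE => /eqP ->; exists f; split=> //.
  move=> x y hx hy; rewrite !lfunE /= => e; apply/eqP; rewrite -subr_eq0; apply/eqP.
  by apply: inj; rewrite ?memvB // linearB /= e subrr.
move=> x s hx; rewrite !lfunE /=; apply: alg_act_translate.
exact: permute_indexM.
Qed.

Lemma innerD u v w : inner u (v + w) = inner u v + inner u w.
Proof. by rewrite /inner -big_split; apply: eq_bigr => x _; rewrite ffunE mulrDr. Qed.
Lemma innerDl u v w : inner (u + v) w = inner u w + inner v w.
Proof.
rewrite /inner -big_split; apply: eq_bigr => x _.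
by rewrite ffunE rmorphD mulrDl.
Qed.
Lemma innerNl u v : inner (- u) v = - inner u v.
Proof. by rewrite /inner -sumrN; apply: eq_bigr => x _; rewrite ffunE rmorphN mulNr. Qed.
Lemma inner0l v : inner 0 v = 0.
Proof. by rewrite /inner big1 // => x _; rewrite ffunE rmorph0 mul0r. Qed.
Lemma innerZ u (c : C) v : inner u (c *: v) = c * inner u v.
Proof. by rewrite /inner mulr_sumr; apply: eq_bigr => x _; rewrite ffunE mulrCA. Qed.
Lemma innerN u v : inner u (- v) = - inner u v.
Proof. by rewrite -scaleN1r innerZ mulN1r. Qed.
Lemma innerB u v w : inner u (v - w) = inner u v - inner u w.
Proof. by rewrite innerD innerN. Qed.
Lemma inner0 u : inner u 0 = 0.
Proof. by rewrite -(subrr (0 : T)) innerB subrr. Qed.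
Lemma inner_sum u (I : finType) (F : I -> T) :
  inner u (\sum_i F i) = \sum_i inner u (F i).
Proof. exact: (big_morph _ (innerD u) (inner0 u)). Qed.

Lemma inner_eq0 u : inner u u = 0 -> u = 0.
Proof.
move=> /eqP; rewrite /inner psumr_eq0 => [/allP h|x _]; last first.
  by rewrite mulrC mul_conjC_ge0.
apply/ffunP => x; rewrite ffunE; apply/eqP; rewrite -mul_conjC_eq0 mulrC.
by apply: h; rewrite mem_index_enum.
Qed.

(** Permutations are unitary. *)
Lemma inner_permute S s u v : inner u (permute S s v) = inner (permute S s^-1%g u) v.
Proof.
rewrite /inner (reindex_inj (h := permute_index S s^-1%g)) /=; last first.
  by apply: (can_inj (g := permute_index S s)) => x;
    rewrite -permute_indexM mulgV permute_index1.
apply: eq_bigr => x _; rewrite /permute !ffunE.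
by rewrite -permute_indexM mulgV permute_index1.
Qed.

(** Uniqueness of the orthogonal projection, by positivity of the inner product; the
projections below are found by exhibiting w. *)
Lemma orth_projE (W : set T) v w : (forall x y, W x -> W y -> W (x - y)) ->
  W w -> (forall u, W u -> inner u (v - w) = 0) -> orth_proj W v = w.
Proof.
move=> WB Ww vw; rewrite /orth_proj.
case: xgetP => [x _ [Wx vx]|/(_ w)]; last by case; split.
apply/eqP; rewrite -subr_eq0; apply/eqP/inner_eq0.
have Wxw := WB _ _ Wx Ww.
have {2}-> : x - w = (v - w) - (v - x) by rewrite opprB [RHS]addrC addrA subrK.
by rewrite innerB vw // vx // subrr.
Qed.

Lemma orth_proj_id (W : set T) v : (forall x y, W x -> W y -> W (x - y)) ->
  W v -> orth_proj W v = v.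
Proof. by move=> WB Wv; apply: orth_projE => // u _; rewrite subrr inner0. Qed.

Lemma symmetric_subspaceB v w : symmetric_subspace v -> symmetric_subspace w ->
  symmetric_subspace (v - w).
Proof. by move=> hv hw s; rewrite permuteB hv hw. Qed.

End TensorPower.

(** * The component of shape (2,2) *)

Section Isotypic22.
Variables (R : realType) (d : leg -> nat) (S : {set leg}).
Local Notation C := R[i].
Local Notation T := (tensor_power_space R d 4).
Local Notation act := (@permute_index d 4 S).
Local Notation A := (@shift R 4 _ act s01).
Local Notation B := (@shift R 4 _ act s02).
Local Notation K1 := (@shift R 4 _ act k1).
Local Notation K2 := (@shift R 4 _ act k2).
Local Notation t22 := (type22 A B K1 K2).
Let rel := klein_sym3_shift R (@permute_index1 d 4 S) (@permute_indexM d 4 S).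

Lemma isotypic22P (v : T) : isotypic S [:: 2; 2] v <-> t22 v.
Proof.
split.
  move: v; apply: isotypic_ind => [|v w|f feq _ u hu].
  - by split; rewrite !shift0 ?addr0.
  - exact: type22D.
  have [h1 h2 h3] := specht22_type hu.
  split; first by rewrite -[LHS](feq u k1 hu) translate_shift h1.
    by rewrite -[LHS](feq u k2 hu) translate_shift h2.
  have e1 : A (B (f u)) = f (translate (translate u s02) s01).
    by rewrite feq ?specht_translate // feq.
  have e2 : B (A (f u)) = f (translate (translate u s01) s02).
    by rewrite feq ?specht_translate // feq.
  by rewrite e1 e2 -!linearD !translate_shift h3 linear0.
move: v; apply: (type22_ind rel).
- by move=> v w; apply: isotypicD.
- by move=> c v; apply: isotypicZ.
- by move=> v; apply: isotypic_permute.
- by move=> v; apply: isotypic_permute.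
move=> w _; rewrite -(alg_act_young22 (@permute_index1 d 4 S) (@permute_indexM d 4 S)).
have [->|ne] := eqVneq (alg_act act w (young_symmetrizer R 4 [:: 2; 2])) 0.
  exact: isotypic0.
apply: isotypic_alg_act; last exact: young_in_specht.
apply: alg_act22_inj ne; [exact: permute_index1 | exact: permute_indexM].
Qed.

Definition part22 (v : T) : T :=
  (12^-1 : C) *: (klein_sum K1 K2 (v + v - A (B v) - B (A v)) : T).

Lemma part22_isotypic (v : T) : isotypic S [:: 2; 2] (part22 v).
Proof. by apply/isotypicZ/isotypic22P/(type22_klein_sum rel). Qed.

(** On a vector u of this component the self-adjoint V acts as 4, and the adjoint of
2 - c - c^2 is itself and acts as 3. *)
Lemma part22_orth (u v : T) :
  isotypic S [:: 2; 2] u -> inner u (v - part22 v) = 0.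
Proof.
move=> /isotypic22P[h1 h2 h3].
have inv s : (s * s = 1)%g -> 
      forall x y : T, inner x (shift act s y) = inner (shift act s x) y.
  move=> ss x y; rewrite [LHS](inner_permute S s x y).
  by rewrite (_ : s^-1 = s)%g //; apply/eqP; rewrite eq_invg_mul ss.
have kleinE (z : T) : inner u (klein_sum K1 K2 z : T) = inner u z *+ 4.
  rewrite /klein_sum !innerD !(inv k1 k1K) !h1 !(inv k2 k2K) !h2.
  by rewrite !mulrS mulr0n addr0 !addrA.
have cycE : inner u v + inner (B (A u) : T) v + inner (A (B u) : T) v = 0.
  by rewrite -!innerDl -addrA [X in _ + X]addrC addrA h3 inner0l.
rewrite innerB innerZ kleinE !innerD !innerN.
rewrite !(inv s01 s01K) !(inv s02 s02K) !(inv s01 s01K).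
set p := inner (B _) v in cycE *; set q := inner (A _) v in cycE *.
have -> : q = - (inner u v + p) by apply/eqP; rewrite -addr_eq0 addrC cycE.
by rewrite -mulr_natl; field.
Qed.

Lemma orth_proj22 (v : T) : orth_proj (isotypic S [:: 2; 2]) v = part22 v.
Proof.
apply: orth_projE => [x y||u]; first exact: isotypicB.
  exact: part22_isotypic.
exact: part22_orth.
Qed.

(** The twelve even permutations with their coefficients, those of the Klein
four-group counted twice. *)
Lemma part22E (v : T) (p := fun g => permute S g v) :
  part22 v = (12^-1 : C) *:
    (p 1%g + p 1%g - p (s02 * s01)%g - p (s01 * s02)%g
     + (p k1 + p k1 - p (s02 * s01 * k1)%g - p (s01 * s02 * k1)%g)
     + (p k2 + p k2 - p (s02 * s01 * k2)%g - p (s01 * s02 * k2)%g)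
     + (p (k2 * k1)%g + p (k2 * k1)%g - p (s02 * s01 * (k2 * k1))%g
        - p (s01 * s02 * (k2 * k1))%g)).
Proof.
rewrite /part22 /klein_sum /p permute1 !(shiftD, shiftN).
by rewrite !(shiftM (@permute_indexM d 4 S)) !mulgA.
Qed.

(** Permuting all legs is permuting those in S and then those outside S, and the
latter commutes with the action that defines the component. *)
Lemma isotypic22_symmetric_action s (v : T) :
  isotypic S [:: 2; 2] v -> isotypic S [:: 2; 2] (permute [set: leg]%SET s v).
Proof.
have split_act : permute [set: leg]%SET s v = permute (~: S)%SET s (permute S s v).
  apply/ffunP => y; rewrite /permute /coords !ffunE; congr (v _).
  apply/ffunP => k; rewrite !ffunE; apply/ffunP => i; rewrite !ffunE !inE.
  by case: (i \in S).
move=> hv; rewrite split_act; have {hv} := isotypic_permute s hv.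
move: (permute S s v) => {split_act}v /isotypic22P[h1 h2 h3].
have com t (w : T) :
    shift act t (permute (~: S)%SET s w : T) = permute (~: S)%SET s (shift act t w).
  apply/ffunP => y; rewrite /permute /coords !ffunE; congr (w _).
  apply/ffunP => k; rewrite !ffunE; apply/ffunP => i; rewrite !ffunE !inE.
  by case: (i \in S).
apply/isotypic22P; split; rewrite !com ?h1 ?h2 //.
by rewrite -!permuteD h3 permute0.
Qed.

(** A unitary map that fixes v and preserves the component fixes the projection of v,
by uniqueness. *)
Lemma part22_symmetric (v : T) :
  symmetric_subspace v -> symmetric_subspace (part22 v).
Proof.
move=> vs s; rewrite -[RHS]orth_proj22; apply/esym/orth_projE => [x y||u hu].
- exact: isotypicB.
- exact/isotypic22_symmetric_action/part22_isotypic.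
rewrite -{1}(vs s) -permuteB inner_permute.
exact/part22_orth/isotypic22_symmetric_action.
Qed.

End Isotypic22.

(** * The sign component *)

Section IsotypicSign.
Variables (R : realType) (n : nat) (lam : seq nat).
Hypothesis row1 : row_stab n lam = [set 1%g]%SET.
Hypothesis colT : col_stab n lam = [set: 'S_n]%SET.
Local Notation C := R[i].
Local Notation Y := (young_symmetrizer R n lam).

(** The antisymmetrizer, without the normalization by n!. *)
Definition alternate (X : finType) (act : 'S_n -> X -> X) (w : {ffun X -> C^o}) :
    {ffun X -> C^o} :=
  \sum_(s : 'S_n) ((-1) ^+ odd_perm s : C) *: shift act s w.

Section Action.
Variables (X : finType) (act : 'S_n -> X -> X).
Hypothesis act1 : forall x, act 1%g x = x.
Hypothesis actM : forall s t x, act (s * t)%g x = act s (act t x).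

Lemma alg_act_young_sign w : alg_act act w Y = alternate act w.
Proof.
rewrite alg_act_young // row1 colT big_set1 /alternate.
by apply: eq_big => [s|s _]; [rewrite inE | rewrite (shift1 act1)].
Qed.

Lemma shift_alternate s w :
  shift act s (alternate act w) = ((-1) ^+ odd_perm s : C) *: alternate act w.
Proof.
rewrite /alternate shift_sum scaler_sumr (reindex_inj (mulIg s^-1%g)) /=.
apply: eq_bigr => t _; rewrite shiftZ (shiftM actM) mulgKV scalerA -signr_addb.
by rewrite odd_permM odd_permV addbC.
Qed.

End Action.

Lemma specht_sign : {in specht R n lam, forall u s,
  translate u s = ((-1) ^+ odd_perm s : C) *: u}.
Proof.
have Ys t : translate Y t = ((-1) ^+ odd_perm t : C) *: Y.
  rewrite -(alg_act_unit Y) alg_act_young_sign; [|exact: rmul1|exact: rmulM].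
  by rewrite translate_shift shift_alternate //; exact: rmulM.
apply: specht_ind => [s|u v hu hv s|c u hu s|t s].
- by rewrite translate_shift shift0 scaler0.
- by rewrite translate_shift shiftD -!translate_shift hu hv scalerDr.
- by rewrite translate_shift shiftZ -!translate_shift hu !scalerA mulrC.
by rewrite translateM !Ys scalerA -signr_addb odd_permM addbC.
Qed.

Lemma specht_sign_span : {in specht R n lam, forall u, exists a : C, u = a *: Y}.
Proof.
have Ys t : translate Y t = ((-1) ^+ odd_perm t : C) *: Y.
  exact/specht_sign/young_in_specht.
apply: specht_ind => [|u v [a ->] [b ->]|c u [a ->]|t].
- by exists 0; rewrite scale0r.
- by exists (a + b); rewrite scalerDl.
- by exists (c * a); rewrite scalerA.
by rewrite Ys; eexists.
Qed.

Variables (d : leg -> nat) (S : {set leg}).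
Local Notation T := (tensor_power_space R d n).
Local Notation act := (@permute_index d n S).

Lemma isotypic_signP (v : T) :
  isotypic S lam v <-> forall s, permute S s v = ((-1) ^+ odd_perm s : C) *: v.
Proof.
have act1 := @permute_index1 d n S; have actM := @permute_indexM d n S.
split.
  move: v; apply: isotypic_ind => [s|v w hv hw s|f feq _ u hu s].
  - by rewrite permute0 scaler0.
  - by rewrite permuteD hv hw scalerDr.
  by rewrite -feq // specht_sign // linearZ.
move=> hv.
have sgnK s : ((-1) ^+ odd_perm s : C) *: (shift act s v : T) = v.
  by rewrite [shift act s v](hv s) scalerA -signr_addb addbb scale1r.
have vYE : alg_act act v Y = (n`!%:R : C) *: (v : T) :> T.
  rewrite alg_act_young_sign // /alternate.
  rewrite (eq_bigr (fun=> v)) => [|s _]; last exact: sgnK.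
  by rewrite sumr_const card_Sn -scaler_nat.
have vE : v = (n`!%:R^-1 : C) *: (alg_act act v Y : T).
  by rewrite vYE scalerA mulVf ?scale1r // pnatr_eq0 -lt0n fact_gt0.
rewrite vE; apply: isotypicZ.
have [->|ne] := eqVneq (alg_act act v Y) 0; first exact: isotypic0.
apply: isotypic_alg_act; last exact: young_in_specht.
move=> u /specht_sign_span[a ->]; rewrite linearZ => /eqP.
by rewrite scaler_eq0 (negPf ne) orbF => /eqP ->; rewrite scale0r.
Qed.

Lemma orth_proj_sign (v : T) :
  orth_proj (isotypic S lam) v = (n`!%:R^-1 : C) *: (alternate act v : T).
Proof.
have actM := @permute_indexM d n S.
apply: orth_projE => [x y||u /isotypic_signP hu]; first exact: isotypicB.
  by apply/isotypicZ/isotypic_signP => s; apply: shift_alternate.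
have signE s : inner u (((-1) ^+ odd_perm s : C) *: (shift act s v : T)) = inner u v.
  rewrite innerZ [inner u _](inner_permute S s u v) hu odd_permV.
  have [_|_] := boolP (odd_perm s); last by rewrite expr0 mul1r scale1r.
  by rewrite expr1 scaleN1r innerNl mulrNN mul1r.
rewrite innerB innerZ /alternate inner_sum (eq_bigr _ (fun s _ => signE s)).
rewrite sumr_const card_Sn -[inner u v *+ _]mulr_natl mulrA.
have nfact_neq0 : n`!%:R != 0 :> C by rewrite pnatr_eq0 -lt0n fact_gt0.
by rewrite mulVf // mul1r subrr.
Qed.
End IsotypicSign.

(** * Projecting the fourth power of the unit tensor *)

Lemma row_stab1111 : row_stab 4 [:: 1; 1; 1; 1]%N = [set 1%g]%SET.
Proof.
apply/setP => p; rewrite !inE; apply/forallP/eqP => [h|-> k]; last by rewrite perm1.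
have idx (k : 'I_4) : reshape_index [:: 1; 1; 1; 1]%N k = k.
  by case: k => [[|[|[|[|//]]]] ?].
by apply/permP => k; apply: val_inj; have /eqP := h k; rewrite !idx perm1.
Qed.

Lemma col_stab1111 : col_stab 4 [:: 1; 1; 1; 1]%N = [set: 'S_4]%SET.
Proof.
apply/setP => p; rewrite !inE; apply/forallP => k.
have off (j : 'I_4) : reshape_offset [:: 1; 1; 1; 1]%N j = 0%N.
  by case: j => [[|[|[|[|//]]]] ?].
by rewrite !off.
Qed.

Section UnitTensor.
Variable R : realType.
Local Notation C := R[i].
Local Notation d := (fun=> 2%N).
Local Notation T := (tensor_power_space R d 4).
Local Notation X := {ffun 'I_4 -> multi_idx d}.

Lemma U2E (m : multi_idx d) :
  U2 R m = [&& m legB == m legA, m legC == m legA & m legD == m legA]%:R.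
Proof.
rewrite ffunE (bigD1 (m legA)) //= [X in _ + X]big1 ?addr0 => [|i ne]; last first.
  by rewrite (bigD1 legA) //= eq_sym (negPf ne) mul0r.
rewrite !big_ord_recl big_ord0.
rewrite (_ : lift _ _ = legB); last exact: val_inj.
rewrite (_ : lift _ _ = legC); last exact: val_inj.
rewrite (_ : lift _ _ = legD); last exact: val_inj.
rewrite (_ : ord0 = legA); last exact: val_inj.
by rewrite eqxx; do 3 case: eqP => _; rewrite ?mul0r ?mulr0 ?mul1r.
Qed.

Definition U2_pow4 : T := tensor_power 4 (U2 R).

Lemma U2_pow4_neq0 (y : X) : U2_pow4 y != 0 :> C ->
  forall k, [/\ y k legB = y k legA, y k legC = y k legA & y k legD = y k legA].
Proof.
rewrite ffunE => /prodf_neq0 h k; have := h k isT; rewrite U2E.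
by case: and3P => [[/eqP ? /eqP ? /eqP ?]|_]; rewrite ?eqxx.
Qed.

(** A coordinate of the fourth power is nonzero only if the four legs agree.  Permuting
B and C together keeps A equal to D and B equal to C. *)
Lemma permute_U2_pow4_supp g (y : X) k : 
  (y k legD != y k legA) || (y k legC != y k legB) ->
  permute BC g U2_pow4 y = 0 :> C.
Proof.
apply: contraTeq; rewrite ffunE => /U2_pow4_neq0 h.
rewrite negb_or !negbK.
have := h k; rewrite !ffunE !inE /= => -[_ _ ->]; rewrite eqxx /=.
by have := h (g^-1%g k); rewrite !ffunE !inE /= permKV => -[-> -> _].
Qed.

Lemma U2_pow4_symmetric (s : 'S_4) : permute [set: leg]%SET s U2_pow4 = U2_pow4.
Proof.
apply/ffunP => y; rewrite !ffunE [RHS](reindex_inj (@perm_inj _ s)) /=.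
apply: eq_bigr => k _; congr (U2 R _); rewrite ffunE.
by apply/ffunP => i; rewrite ffunE inE.
Qed.
(** In the tableau of shape (2,2) with entries 0, 1, 2, 3, the row and the column of
the entry k. *)
Definition row_bit (k : 'I_4) : 'I_2 := if (1 < k)%N then ord_max else ord0.
Definition col_bit (k : 'I_4) : 'I_2 := if odd k then ord_max else ord0.

Lemma bits_inj (j k : 'I_4) : row_bit j = row_bit k -> col_bit j = col_bit k -> j = k.
Proof.
rewrite /row_bit /col_bit => h h'; apply: val_inj; move: h h' => /eqP + /eqP.
by case: j => [[|[|[|[|//]]]] ?]; case: k => [[|[|[|[|//]]]] ?].
Qed.

(** The four factors A, B, C, D carry the strings 0011, 0101, 0101, 0011. *)
Definition witness_idx : X :=
  [ffun k => finfun (fun i : leg => if i \in BC then col_bit k else row_bit k)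
     : multi_idx d].

(** The coordinate is 1 exactly when g turns the string 0101 into 0011. *)
Lemma permute_U2_pow4_witness g : permute BC g U2_pow4 witness_idx =
  [&& ~~ odd (g (pt 0)), ~~ odd (g (pt 1)), odd (g (pt 2)) & odd (g (pt 3))]%:R :> C.
Proof.
have bitE k : U2 R (permute_index BC g witness_idx k) = (odd (g k) == (1 < k)%N)%:R.
  rewrite U2E !ffunE !inE /= eqxx andbT andbb /col_bit /row_bit.
  by case: (odd _); case: (1 < k)%N.
rewrite ffunE ffunE !big_ord_recl big_ord0 !bitE.
rewrite (_ : lift _ (lift _ (lift _ _)) = pt 3); last exact: val_inj.
rewrite (_ : lift _ (lift _ _) = pt 2); last exact: val_inj.
rewrite (_ : lift _ _ = pt 1); last exact: val_inj.
rewrite (_ : ord0 = pt 0); last exact: val_inj.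
by rewrite mulr1 /= !eqbF_neg !eqb_id; do 4 case: odd; rewrite ?mul0r ?mulr0 ?mul1r.
Qed.

(** A permutation of A and B that preserves both strings is the identity. *)
Lemma part22_supp s : s != 1%g ->
  part22 BC U2_pow4 (permute_index AB s witness_idx) = 0 :> C.
Proof.
move=> s1; have [k hk] : exists k, s k != k.
  apply/existsP; apply: contraR s1; rewrite negb_exists => /forallP h.
  by apply/eqP/permP => k; rewrite perm1; apply/eqP; have := h k; rewrite negbK.
have zero g : permute BC g U2_pow4 (permute_index AB s witness_idx) = 0 :> C.
  apply: (permute_U2_pow4_supp g (k := k)); rewrite !ffunE !inE /=.
  rewrite -negb_and; apply: contraNN hk => /andP[/eqP h1 /eqP h2].
  by apply/eqP/bits_inj.
by rewrite part22E [LHS]ffunE !(ffunE_add, ffunE_opp) !zero !(addr0, subr0) [LHS]mulr0.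
Qed.

(** Of the twelve even permutations, exactly two turn 0101 into 0011, and both are
3-cycles, with coefficient -1/12. *)
Lemma part22_witness : part22 BC U2_pow4 witness_idx = - 6^-1 :> C.
Proof.
rewrite part22E [LHS]ffunE !(ffunE_add, ffunE_opp).
rewrite !permute_U2_pow4_witness s01.unlock s02.unlock k1.unlock k2.unlock.
do 12 ?[progress rewrite ?permM ?perm1 ?permE /=].
by rewrite /GRing.scale /=; field.
Qed.

Lemma proj_neq0 :
  Defs.proj AB [:: 1; 1; 1; 1]%N (Defs.proj BC [:: 2; 2]%N (tensor_power 4 (U2 R))) != 0.
Proof.
have vs : symmetric_subspace U2_pow4 := U2_pow4_symmetric.
have symB := @symmetric_subspaceB R d 4.
rewrite /Defs.proj (orth_proj_id symB vs) orth_proj22.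
rewrite (orth_proj_id symB (part22_symmetric _ vs)).
rewrite (orth_proj_sign row_stab1111 col_stab1111).
apply/eqP => /ffunP/(_ witness_idx); rewrite [LHS]ffunE [RHS]ffunE => /eqP.
rewrite /alternate sum_ffunE (bigD1 1%g) //= big1 => [|s s1]; last first.
  rewrite ffunE [X in _ *: X](_ : _ = 0) ?scaler0 // ffunE; exact: part22_supp.
rewrite addr0 odd_perm1 expr0 scale1r ffunE permute_index1 part22_witness.
by rewrite mulf_eq0 invr_eq0 pnatr_eq0 oppr_eq0 invr_eq0 pnatr_eq0.
Qed.

End UnitTensor.

(** * The value of the upper functional *)

Section Upper.
Variable R : realType.

Let ln2_neq0 : ln (2 : R) != 0.
Proof. by rewrite gt_eqF // ln_gt0 // ltr1n. Qed.

Lemma shape_entropy22 : shape_entropy R 4 [:: 2; 2]%N = 1.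
Proof.
rewrite /shape_entropy /shannon /= !big_cons big_nil.
rewrite (_ : 2%:R / 4%:R = 2^-1 :> R); last by field.
by rewrite lnV ?posrE ?ltr0n //; field.
Qed.

Lemma shape_entropy1111 : shape_entropy R 4 [:: 1; 1; 1; 1]%N = 2.
Proof.
rewrite /shape_entropy /shannon /= !big_cons big_nil.
rewrite (_ : 1 / 4%:R = (2 ^+ 2)^-1 :> R); last by field.
by rewrite lnV ?posrE ?exprn_gt0 ?ltr0n // lnXn ?ltr0n //; field.
Qed.

Lemma E_upper_gt1 (t : R) : 0 < t -> (1 < E_upper (theta_of t) (U2 R))%E.
Proof.
move=> t0; apply: (@lt_le_trans _ _ (1 + t)%:E).
  by rewrite lte_fin ltrDl.
apply: ereal_sup_ubound; exists 4%N, [:: 1; 1; 1; 1]%N, [:: 2; 2]%N; split=> //.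
  exact: proj_neq0.
rewrite shape_entropy22 shape_entropy1111 /theta_of eqxx (negPf BC_neq_AB) eqxx.
by congr _%:E; ring.
Qed.

End Upper.

Theorem theoremD1 (R : realType) (t : R) (ht0 : 0 < t) (ht1 : t < 1) :
  (E_lower (theta_of t) (U2 R) <= 1)%E /\ (1 < E_upper (theta_of t) (U2 R))%E.
Proof. by split; [exact: E_lower_le1 | exact: E_upper_gt1]. Qed.
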